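(* For any Hausdorff space $X$, we have $so\omega(X)=so\omega(\mathcal{S}(X))$.
   Context: For a Hausdorff space $X$, $\mathcal{S}(X)$ is the set of all nonempty subsets of $X$ that are unions of finitely many convergent sequences of $X$, where a convergent sequence is understood as a set $\{x_j:j\in\mathbb{N}\}\cup\{x\}$ with $x_j\to x$ in $X$ (trivial, i.e. constant, sequences allowed). $\mathcal{S}(X)$ carries the Vietoris topology, whose basic open sets are $\langle U_1,\dots,U_r\rangle=\{S\in\mathcal{S}(X): S\subset\bigcup_{i=1}^r U_i \text{ and } S\cap U_j\neq\emptyset \text{ for } 1\le j\le r\}$ with $r\in\mathbb{N}$ and $U_1,\dots,U_r$ open in $X$. Let $Y$ be a space. A subset $P\subset Y$ is a sequential neighborhood of $y\in Y$ if $y\in P$ and each sequence converging to $y$ is eventually in $P$; $P$ is sequentially open if it is a sequential neighborhood of each of its points. An so-network at a point $y\in Y$ is a family $\mathcal{P}_y$ of sequentially open sets containing $y$ such that (a) for all $U,V\in\mathcal{P}_y$ there is $W\in\mathcal{P}_y$ with $W\subset U\cap V$, and (b) for each open neighborhood $U$ of $y$ there is $P\in\mathcal{P}_y$ with $y\in P\subset U$. An so-network of $Y$ is a cover $\mathcal{P}=\bigcup_{y\in Y}\mathcal{P}_y$ of $Y$ where each $\mathcal{P}_y$ is an so-network at $y$. Define $so\omega(Y)=\aleph_0+\min\{|\mathcal{N}|:\mathcal{N}\text{ is an so-network of }Y\}$. *)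

(* Defs.v *)
From HB Require Import structures.
From mathcomp Require Import all_boot all_order.
From mathcomp Require Import all_classical topology.

Set Implicit Arguments.
Unset Strict Implicit.
Unset Printing Implicit Defensive.

Local Open Scope classical_set_scope.

Definition convergent_sequence_set (X : topologicalType) (A : set X) : Prop :=
  exists (u : nat -> X) (x : X), u @ \oo --> x /\ A = range u `|` [set x].

Definition finite_sequence_unions (X : topologicalType) : set (set X) :=
  [set A | A !=set0 /\
     exists (n : nat) (F : 'I_n -> set X),
       (forall i, convergent_sequence_set (F i)) /\ A = \bigcup_i F i].

(* [S_space X] is the hyperspace S(X); [sval S : set X] is the underlying
   subset of a point S : S_space X. *)
Definition S_space (X : topologicalType) : Type :=
  set_type (@finite_sequence_unions X).

HB.instance Definition _ (X : topologicalType) := Choice.on (S_space X).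

Definition vietoris (X : topologicalType) (r : nat) (U : 'I_r -> set X) :
    set (S_space X) :=
  [set S | sval S `<=` \bigcup_i U i /\ forall j, sval S `&` U j !=set0].

Definition vietoris_base (X : topologicalType) : set (set (S_space X)) :=
  [set B | exists (r : nat) (U : 'I_r -> set X),
     (forall i, open (U i)) /\ B = vietoris U].

Lemma S_space_neq0 (X : topologicalType) (S : S_space X) : sval S !=set0.
Proof. by case: S => A /= /set_mem []. Qed.

Lemma vietoris_base_cover (X : topologicalType) :
  \bigcup_(B in @vietoris_base X) id B = setT.
Proof.
apply/seteqP; split=> // S _.
exists (vietoris (fun _ : 'I_1 => [set: X])).
  by exists 1%N, (fun=> setT); split=> // _; exact: openT.
split=> [x _|j]; first by exists ord0.
by rewrite setIT; exact: S_space_neq0.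
Qed.

Lemma vietoris_base_join (X : topologicalType) (B C : set (S_space X)) S :
  vietoris_base B -> vietoris_base C -> id B S -> id C S ->
  exists D, [/\ vietoris_base D, id D S & id D `<=` id B `&` id C].
Proof.
move=> [r [U [oU ->]]] [s [V [oV ->]]] [SU SUj] [SV SVj].
pose W (i : 'I_(r + s)) := match fintype.split i with
  | inl j => U j `&` \bigcup_k V k
  | inr k => (\bigcup_j U j) `&` V k end.
have WU j : W (lshift s j) = U j `&` \bigcup_k V k.
  by rewrite /W -[lshift s j]/(unsplit (inl j)) unsplitK.
have WV k : W (rshift r k) = (\bigcup_j U j) `&` V k.
  by rewrite /W -[rshift r k]/(unsplit (inr k)) unsplitK.
have WUV : \bigcup_i W i `<=` (\bigcup_j U j) `&` (\bigcup_k V k).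
  move=> x [i _]; rewrite /W; case: fintype.split => [j|k] [].
    by move=> Ux Vx; split=> //; exists j.
  by move=> Ux Vx; split=> //; exists k.
exists (vietoris W); split.
- exists (r + s)%N, W; split=> // i; rewrite /W; case: fintype.split => [j|k].
    by apply: openI => //; apply: bigcup_open.
  by apply: openI => //; apply: bigcup_open.
- split=> [x Sx|i].
    have [j _ Ux] := SU _ Sx; exists (lshift s j) => //; rewrite WU.
    by split=> //; exact: SV.
  rewrite /W; case: fintype.split => [j|k].
    by have [x [Sx Ux]] := SUj j; exists x; split=> //; split=> //; exact: SV.
  by have [x [Sx Vx]] := SVj k; exists x; split=> //; split=> //; exact: SU.
- move=> T [TW TWj]; split; split.
  + by move=> x /TW /WUV [].
  + by move=> j; have := TWj (lshift s j); rewrite WU => -[x [Tx [Ux _]]]; exists x.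
  + by move=> x /TW /WUV [].
  + by move=> k; have := TWj (rshift r k); rewrite WV => -[x [Tx [_ Vx]]]; exists x.
Qed.

HB.instance Definition _ (X : topologicalType) :=
  isBaseTopological.Build (S_space X)
    (@vietoris_base_cover X) (@vietoris_base_join X).

Section SoWeight.
Variable Y : topologicalType.

Definition seq_nbhs (y : Y) (P : set Y) : Prop :=
  P y /\ forall u : nat -> Y, u @ \oo --> y -> \forall n \near \oo, P (u n).

Definition seq_open (P : set Y) : Prop := forall y, P y -> seq_nbhs y P.

Definition so_network_at (y : Y) (P : set (set Y)) : Prop :=
  [/\ forall A, P A -> seq_open A /\ A y,
      forall U V, P U -> P V -> exists2 W, P W & W `<=` U `&` V
    & forall U, open U -> U y -> exists2 A, P A & A y /\ A `<=` U].

Definition so_network (N : set (set Y)) : Prop :=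
  \bigcup_(A in N) A = setT /\
  exists Ny : Y -> set (set Y),
    (forall y, so_network_at y (Ny y)) /\ N = \bigcup_y Ny y.

End SoWeight.

Definition min_card (T : Type) (F : set (set T)) (M : set T) : Prop :=
  F M /\ forall N, F N -> (M #<= N)%card.

(* Cardinals are represented by sets up to equipotence [#=]: [min_so_network Y]
   is a chosen so-network of least cardinality, and [so_weight Y] is the
   disjoint union of nat with it, so its cardinality is aleph_0 + |N|. *)
Definition min_so_network (Y : topologicalType) : set (set Y) :=
  get (min_card (@so_network Y)).
Arguments min_so_network : clear implicits.

Definition so_weight (Y : topologicalType) : set (nat + set Y) :=
  inl @` [set: nat] `|` inr @` min_so_network Y.
Arguments so_weight : clear implicits.

(* A nonempty family of sets has a member of least cardinality: a maximal set of
   sections of the family on which every evaluation is injective has an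
   evaluation that is onto. *)
Lemma min_card_exists (T : Type) (F : set (set T)) :
  F !=set0 -> exists M, min_card F M.
Proof.
move=> [N0 FN0].
pose P (G : set (set T -> T)) := forall N, F N ->
  (forall g, G g -> N (g N)) /\
  (forall g h, G g -> G h -> g N = h N -> g = h).
have [G [PG maxG]] : exists G, P G /\ forall H, G `<` H -> ~ P H.
  apply: Zorn_bigcup => C CP totC N FN; split.
    by move=> g [H CH Hg]; have [+ _] := CP _ CH _ FN; exact.
  move=> g h [H CH Hg] [K CK Kh] gh.
  have [HK|KH] := totC _ _ CH CK.
    by have [_ /(_ g h)] := CP _ CK _ FN; apply => //; exact: HK.
  by have [_ /(_ g h)] := CP _ CH _ FN; apply => //; exact: KH.
have [M FM Monto] : exists2 M, F M & M `<=` (fun g => g M) @` G.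
  apply: contrapT => noM.
  have miss N : exists x, F N -> N x /\ forall g, G g -> g N <> x.
    have [FN|nFN] := pselect (F N); last first.
      have [x0] : exists x : T, True.
        apply: contrapT => nT; apply: noM; exists N0 => // x _.
        by case: nT; exists x.
      by exists x0.
    apply: contrapT => nx; apply: noM; exists N => // x Nx.
    apply: contrapT => nGx; apply: nx; exists x => _; split=> // g Gg gx.
    by apply: nGx; exists g.
  have [f fP] := choice miss.
  apply: (maxG (G `|` [set f])).
    split; first by move=> g Gg; left.
    move=> /(_ f (or_intror erefl)) Gf.
    by have [_ /(_ _ Gf)] := fP _ FN0; exact.
  move=> N FN; have [Nf nf] := fP _ FN; have [GN Ginj] := PG _ FN; split.
    by move=> g [/GN//|->].
  move=> g h [Gg|->] [Gh|->] // gh.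
  - exact: Ginj.
  - by case: (nf _ Gg).
  - by case: (nf _ Gh).
exists M; split=> // N FN.
apply: (card_le_trans (subset_card_le Monto)).
apply: (card_le_trans (card_image_le _ _)).
have [GN Ginj] := PG _ FN.
have injN : {in G &, injective (fun g : set T -> T => g N)}.
  by move=> g h /set_mem Gg /set_mem Gh; exact: Ginj.
rewrite -(card_le_eql (inj_card_eq injN)).
by apply: subset_card_le => _ [g Gg <-]; exact: GN.
Qed.

Lemma so_network_exists (Y : topologicalType) : @so_network Y !=set0.
Proof.
pose Ny (y : Y) := [set A : set Y | open A /\ A y].
exists (\bigcup_y Ny y); split.
  apply/seteqP; split=> // y _; exists setT => //; exists y => //.
  by split=> //; exact: openT.
exists Ny; split=> // y; split.
- move=> A [oA Ay]; split=> // z Az; split=> // u uz.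
  by apply: uz; exact: open_nbhs_nbhs.
- move=> U V [oU Uy] [oV Vy]; exists (U `&` V) => //.
  by split; [exact: openI|split].
- by move=> U oU Uy; exists U; split.
Qed.

Lemma min_so_networkP (Y : topologicalType) :
  min_card (@so_network Y) (min_so_network Y).
Proof. exact: (getPex (min_card_exists (so_network_exists Y))). Qed.

(* Main.v *)
Require Import Defs.
From mathcomp Require Import all_boot all_order.
From mathcomp Require Import all_classical topology.

(** Both inequalities rest on the map sending x to its singleton and on the sets
    <P_1, ..., P_r> = vietoris_seq [:: P_1; ...; P_r] of all S covered by the
    P_i and meeting each of them.

    The map x |-> {x} is continuous, so it pulls sequentially open sets back to
    sequentially open sets, and an so-network of S(X) back to an so-network of X
    that is no larger (so_network_pullback).

    Conversely let N be an so-network of X.  The sets <P_1, ..., P_r> with P_i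
    in N are sequentially open in S(X) (seq_open_vietoris_seq).  The reason is
    that S in S(X) is a countable compact subset of a Hausdorff space: every
    point s of X has countably many neighbourhoods G_m such that points y_m of
    G_m converge to s as soon as the y_m are eventually in each open
    neighbourhood of S.  If S_n converges
    to S and P is a sequential neighbourhood of s, then some S_n `&` G_m must
    lie in P for almost all n, for otherwise points of S_n `&` G_m outside P
    would form a sequence converging to s (seq_nbhs_local_subset).  This one
    local statement yields both that P_i is eventually hit, and, by
    compactness, that the union of the P_i eventually covers.

    The sets <P_1, ..., P_r> also refine every open neighbourhood of S
    (vietoris_seq_refines).  They do not obviously form filter bases: a set
    P_1 taken from the local network at one point need not be refined by the
    local network at another point of P_1.  The nonempty finite intersections
    of the sets <P_1, ..., P_r> do, with all those containing S as the local
    network at S, and form an so-network (so_network_finI).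

    That so-network is indexed by finite sequences of finite sequences of
    members of N, so its cardinality is at most aleph_0 + |N| because an
    infinite set has no more finite sequences than elements
    (infinite_card_seq).  The latter follows from |T * T| = |T| for infinite T,
    proved with Zorn's lemma (infinite_card_square). *)

Set Implicit Arguments.
Unset Strict Implicit.
Unset Printing Implicit Defensive.
Local Open Scope classical_set_scope.
Local Open Scope card_scope.

(** * Cardinals: comparability, squares and finite sequences *)

Lemma card_le_injection (T U : Type) (u0 : U) (A : set T) (B : set U) :
  A #<= B -> exists f : T -> U, (forall x, A x -> B (f x)) /\
    (forall x y, A x -> A y -> f x = f y -> x = y).
Proof.
move=> /card_leP[f].
exists (fun x => if pselect (A x) is left Ax then sval (f (SigSub (mem_set Ax)))
                 else u0).
split=> [x Ax|x y Ax Ay].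
  by case: pselect => // Ax'; exact: set_valP.
case: pselect => // Ax'; case: pselect => // Ay' /val_inj fxy.
have xy := @inj _ _ _ f _ _ (mem_set I) (mem_set I) fxy.
exact: (congr1 val xy).
Qed.

Lemma injection_card_le (T U : Type) (A : set T) (B : set U) (f : T -> U) :
  (forall x, A x -> B (f x)) ->
  (forall x y, A x -> A y -> f x = f y -> x = y) -> A #<= B.
Proof.
move=> fAB fI.
have finj : {in A &, injective f} by move=> x y /set_mem Ax /set_mem Ay; exact: fI.
rewrite -(card_le_eql (inj_card_eq finj)).
by apply: subset_card_le => _ [x Ax <-]; exact: fAB.
Qed.

(** A member of least cardinality of the family {A, B} embeds in the other one. *)
Lemma card_le_total (T : Type) (A B : set T) : A #<= B \/ B #<= A.
Proof.
have [|M [MAB Mmin]] := @min_card_exists T [set A; B]; first by exists A; left.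
by case: MAB Mmin => -> Mmin; [left|right]; apply: Mmin; [right|left].
Qed.

Lemma inhabited_of_infinite (T : Type) : [set: nat] #<= [set: T] -> inhabited T.
Proof.
by move=> /card_leP[f]; exists; exact: val (f (SigSub (mem_set (I : setT 0%N)))).
Qed.

Section Hessenberg.
Variable T : Type.

Definition pairing_support (R : set (T * T * T)) : set T :=
  [set x | exists z, R (x, x, z)].

(** The partial pairings ordered by Zorn's lemma: every choice function of R is an
    injection of D * D into D, where D is the support.  Functionality of R is
    not imposed: injectivity is all that matters, and it frees the extension
    step from distinguishing old pairs from new ones. *)
Definition pairing_rel (R : set (T * T * T)) : Prop :=
  [/\ forall x y, pairing_support R x -> pairing_support R y -> exists z, R (x, y, z),
      forall p z, R (p, z) -> pairing_support R z
    & forall p q z, R (p, z) -> R (q, z) -> p = q].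

Lemma pairing_rel_bigcup (F : set (set (T * T * T))) :
  F `<=` pairing_rel -> total_on F subset -> pairing_rel (\bigcup_(R in F) R).
Proof.
move=> FP Ftot; set U := \bigcup_(R in F) R.
have supU R x : F R -> pairing_support R x -> pairing_support U x.
  by move=> FR [z Rz]; exists z, R.
have join R Q : F R -> F Q -> exists2 K, F K & R `<=` K /\ Q `<=` K.
  move=> FR FQ; case: (Ftot _ _ FR FQ) => [RQ|QR]; last by exists R; last split.
  by exists Q; last split.
split.
- move=> x y [a [R FR Ra]] [b [Q FQ Qb]]; have [K FK [RK QK]] := join R Q FR FQ.
  have [KT _ _] := FP K FK.
  have [||z Kz] := KT x y; first by exists a; exact: RK.
    by exists b; exact: QK.
  by exists z, K.
- by move=> p z [R FR Rz]; apply: (supU R) => //; have [_ /(_ p z Rz)] := FP R FR.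
- move=> p q z [R FR Rz] [Q FQ Qz]; have [K FK [RK QK]] := join R Q FR FQ.
  by have [_ _ Kinj] := FP K FK; apply: (Kinj p q z); [exact: RK|exact: QK].
Qed.

(** If h embeds D in its complement, a pairing of D extends to one of
    D `|` h @` D: encode each of two elements by a boolean and an element of D,
    pair the two elements of D, pair the result with a code g (b1 + 2 * b2) of
    the two booleans, and apply h so that new codes avoid the old ones. *)
Lemma pairing_rel_extend (R : set (T * T * T)) (g : nat -> T) (h : T -> T) :
  pairing_rel R -> injective g -> (forall n, pairing_support R (g n)) ->
  (forall x, pairing_support R x -> ~ pairing_support R (h x)) ->
  (forall x y, pairing_support R x -> pairing_support R y -> h x = h y -> x = y) ->
  exists R', [/\ pairing_rel R', R `<=` R' & pairing_support R' (h (g 0%N))].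
Proof.
set D := pairing_support R => -[Rtot Rim Rinj] ginj Dg hD hinj.
pose dec (b : bool) d := if b then h d else d.
have decI b d b' d' : D d -> D d' -> dec b d = dec b' d' -> (b, d) = (b', d').
  move=> Dd Dd'; case: b; case: b' => //= e.
  - by rewrite (hinj d d').
  - by case: (hD d Dd); rewrite e.
  - by case: (hD d' Dd'); rewrite -e.
  - by rewrite e.
pose tag (b b' : bool) := g (b + b'.*2)%N.
have tagI b1 b2 b1' b2' : tag b1 b2 = tag b1' b2' -> (b1, b2) = (b1', b2').
  by move=> /ginj; case: b1; case: b2; case: b1'; case: b2'.
pose N := [set r | exists b1 d1 b2 d2 v w, [/\ D d1, D d2, R (d1, d2, v),
  R (v, tag b1 b2, w) & r = (dec b1 d1, dec b2 d2, h w)]].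
pose R' := R `|` N.
have newR' b1 d1 b2 d2 : D d1 -> D d2 -> exists z, R' (dec b1 d1, dec b2 d2, z).
  move=> D1 D2; have [v Rv] := Rtot d1 d2 D1 D2.
  have [w Rw] := Rtot v (tag b1 b2) (Rim _ _ Rv) (Dg _).
  by exists (h w); right; exists b1, d1, b2, d2, v, w.
have supR' x : pairing_support R' x <-> exists b d, D d /\ x = dec b d.
  split=> [[z [Rz|[b1 [d1 [_ [_ [_ [_ [D1 _ _ _ [-> _ _]]]]]]]]]]|[b [d [Dd ->]]]].
  - by exists false, x; split=> //; exists z.
  - by exists b1, d1.
  - exact: newR'.
exists R'; split; [split| by move=> r; left|].
- move=> _ _ /supR'[b1 [d1 [D1 ->]]] /supR'[b2 [d2 [D2 ->]]]; exact: newR'.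
- move=> p z [/Rim Dz|[b1 [d1 [b2 [d2 [v [w [_ _ _ /Rim Dw [_ ->]]]]]]]]];
    apply/supR'; first by exists false, z.
  by exists true, w.
- move=> p q z [Rp|[b1 [d1 [b2 [d2 [v [w [D1 D2 Rv Rw [-> ez]]]]]]]]]
    [Rq|[b1' [d1' [b2' [d2' [v' [w' [D1' D2' Rv' Rw' [-> ez']]]]]]]]].
  + exact: Rinj Rp Rq.
  + by case: (hD w' (Rim _ _ Rw')); rewrite -ez'; exact: Rim Rp.
  + by case: (hD w (Rim _ _ Rw)); rewrite -ez; exact: Rim Rq.
  + have ww : w = w' by apply: hinj; [exact: Rim Rw|exact: Rim Rw'|rewrite -ez].
    rewrite -ww in Rw'; have [vv /tagI [<- <-]] := Rinj _ _ _ Rw Rw'.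
    by rewrite -vv in Rv'; have [<- <-] := Rinj _ _ _ Rv Rv'.
- by apply/supR'; exists true, (g 0%N).
Qed.

(** The maximal relation is made to contain the pairing of the copy g @` setT of
    nat, so that its support is infinite and provides codes for booleans. *)
Lemma pairing_rel_maximal (g : nat -> T) : injective g ->
  exists R, [/\ pairing_rel R, forall n, pairing_support R (g n) &
    forall R', pairing_rel R' -> R `<=` R' -> R' `<=` R].
Proof.
move=> ginj; pose R0 := [set r | exists i j, r = (g i, g j, g (pickle (i, j)))].
have pairR0 : pairing_rel R0.
  split.
  - move=> x y [_ [i [_ [-> _ _]]]] [_ [j [_ [-> _ _]]]].
    by exists (g (pickle (i, j))), i, j.
  - move=> p z [i [j [_ ->]]]; set k := pickle _.
    by exists (g (pickle (k, k))), k, k.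
  - move=> p q z [i [j [-> ->]]] [i' [j' [-> /ginj /(pcan_inj pickleK)]]].
    by move=> [-> ->].
(* Sets A are ordered instead of the relations containing R0, so that the empty
   chain has an upper bound too. *)
have [F FP Ftot|A [PA Amax]] :=
    @Zorn_bigcup _ [set A | pairing_rel (R0 `|` A)].
  rewrite /mkset; have -> : R0 `|` \bigcup_(R in F) R =
      \bigcup_(R in R0 |` [set R0 `|` A | A in F]) R.
    apply/seteqP; split=> [r [Rr|[A FA Ar]]|r [_ [->|[A FA <-]]]].
    - by exists R0 => //; left.
    - by exists (R0 `|` A); right => //; exists A.
    - by left.
    - by move=> [|Ar]; [left|right; exists A].
  apply: pairing_rel_bigcup => [_ [->//|[A FA <-]]|]; first exact: FP.
  move=> _ _ [->|[A FA <-]] [->|[B FB <-]].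
  - by left.
  - by left; left.
  - by right; left.
  - by have [AB|BA] := Ftot A B FA FB; [left|right]; exact: setUS.
exists (R0 `|` A); split=> // [n|R' PR' AR'].
  by exists (g (pickle (n, n))); left; exists n, n.
apply: contrapT => nR'; apply: (Amax (A `|` R')).
  split; first exact: subsetUl.
  by move=> R'A; apply: nR' => r R'r; right; apply: R'A; right.
rewrite /mkset; suff -> : R0 `|` (A `|` R') = R' by [].
rewrite setUA; exact: setUidr.
Qed.

(** Let D be the support of a maximal pairing.  The complement of D embeds in D,
    since otherwise D would embed in its complement by comparability and the
    pairing would extend.  So T embeds in D by the pairing with one of two fixed
    elements, and T * T embeds in D * D, hence in D. *)
Theorem infinite_card_square : [set: nat] #<= [set: T] ->
  [set: T * T] #<= [set: T].
Proof.
move=> natT; have [t0] := inhabited_of_infinite natT.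
have [g [_ gI]] := card_le_injection t0 natT.
have ginj : injective g by move=> m n; exact: gI.
have [R [PR Rg Rmax]] := pairing_rel_maximal ginj.
set D := pairing_support R in Rg.
have CD : ~` D #<= D.
  have [DC|//] := card_le_total D (~` D).
  have [h [hD hI]] := card_le_injection t0 DC; exfalso.
  have [R' [PR' RR' [z R'h]]] := pairing_rel_extend PR ginj Rg hD hI.
  by apply: (hD _ (Rg 0%N)); exists z; exact: Rmax PR' RR' _ R'h.
have [h [hD hI]] := card_le_injection t0 CD.
have [Rtot Rim Rinj] := PR.
have [p pP] : exists p : T * T -> T, forall x y, D x -> D y -> R (x, y, p (x, y)).
  have [|p pP] := @choice _ _ (fun xy z => D xy.1 -> D xy.2 -> R (xy.1, xy.2, z)).
    move=> [x y] /=; have [Dx|nDx] := pselect (D x); last by exists t0.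
    have [Dy|nDy] := pselect (D y); last by exists t0.
    by have [z] := Rtot x y Dx Dy; exists z.
  by exists p => x y; exact: (pP (x, y)).
have pD x y : D x -> D y -> D (p (x, y)) by move=> Dx Dy; exact: Rim (pP x y Dx Dy).
have pI x y x' y' : p (x, y) = p (x', y') ->
    D x -> D y -> D x' -> D y' -> (x, y) = (x', y').
  move=> e Dx Dy Dx' Dy'; apply: Rinj (pP x y Dx Dy) _.
  by rewrite e; exact: pP.
pose e x := if pselect (D x) is left _ then p (x, g 0%N) else p (h x, g 1%N).
have eD x : D (e x) by rewrite /e; case: pselect => [Dx|/hD Dx]; exact: pD.
have eI : injective e.
  move=> x y; rewrite /e; case: pselect => Dx; case: pselect => Dy /pI.
  - by move=> /(_ Dx (Rg _) Dy (Rg _)) [].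
  - by move=> /(_ Dx (Rg _) (hD _ Dy) (Rg _)) [_ /ginj].
  - by move=> /(_ (hD _ Dx) (Rg _) Dy (Rg _)) [_ /ginj].
  - by move=> /(_ (hD _ Dx) (Rg _) (hD _ Dy) (Rg _)) [/(hI _ _ Dx Dy)].
apply: (injection_card_le (f := fun xy : T * T => p (e xy.1, e xy.2))) => //.
move=> [x y] [x' y'] _ _ /= /pI /(_ (eD _) (eD _) (eD _) (eD _)).
by move=> [/eI -> /eI ->].
Qed.

End Hessenberg.

(** Folding the pairing encodes sequences of a given length injectively; the
    length is recorded as well. *)
Lemma infinite_card_seq (T : Type) : [set: nat] #<= [set: T] ->
  [set: seq T] #<= [set: T].
Proof.
move=> natT; have [t0] := inhabited_of_infinite natT.
have [g [_ gI]] := card_le_injection t0 natT.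
have [p [_ pI]] := card_le_injection t0 (infinite_card_square natT).
pose enc := foldr (fun x c => p (x, c)) t0.
apply: (@injection_card_le _ _ _ _ (fun s => p (g (size s), enc s))) => //.
move=> s s' _ _ /(pI _ _ I I) [/(gI _ _ I I)].
elim: s s' => [|x s IHs] [|x' s'] //= [ss'] /(pI _ _ I I) [-> ee].
by rewrite (IHs s').
Qed.

(** * Finite unions of convergent sequences as countable compact sets *)

(** Compactness for covers by sequential neighbourhoods: the neighbourhood of
    the limit contains a tail of the sequence, whether or not it is open.  Open
    covers are a special case. *)
Lemma finite_sequence_union_seq_compact (X : topologicalType) (S : set X)
    (P : X -> set X) :
  finite_sequence_unions S -> (forall x, S x -> seq_nbhs x (P x)) ->
  exists s : seq X, (forall x, x \in s -> S x) /\
    S `<=` [set y | exists2 x, x \in s & P x y].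
Proof.
move=> [_ [n [F [cF ->]]]] PS.
have coverF i : exists s : seq X, (forall x, x \in s -> F i x) /\
    F i `<=` [set y | exists2 x, x \in s & P x y].
  have [u [x [ux FE]]] := cF i.
  have Fx : F i x by rewrite FE; right.
  have [Px /(_ u ux) [N _ uP]] := PS x (ex_intro2 _ _ i I Fx).
  exists (x :: [seq u k | k <- iota 0 N]); split.
    move=> y; rewrite inE => /predU1P[->//|/mapP[k _ ->]].
    by rewrite FE; left; exists k.
  rewrite FE => y [[k _ <-]|->]; last by exists x; rewrite ?mem_head.
  have [Nk|kN] := leqP N k; first by exists x; [rewrite mem_head|exact: uP].
  exists (u k); last first.
    by apply: (PS _ _).1; exists i => //; rewrite FE; left; exists k.
  by rewrite inE; apply/orP; right; apply/mapP; exists k => //; rewrite mem_iota.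
have [s sP] := choice coverF.
exists (flatten [seq s i | i <- enum 'I_n]); split.
  move=> x /flattenP[_ /mapP[i _ ->] xs]; exists i => //; exact: (sP i).1.
move=> y [i _ /(sP i).2 [x xs Pxy]]; exists x => //.
by apply/flattenP; exists (s i) => //; apply/mapP; exists i; rewrite ?mem_enum.
Qed.

Lemma finite_sequence_union_enum (X : topologicalType) (S : set X) :
  finite_sequence_unions S -> exists t : nat -> X, S `<=` range t.
Proof.
move=> [[x0 _] [n [F [cF ->]]]].
have enumF i : exists t : nat -> X, F i `<=` range t.
  have [u [x [_ ->]]] := cF i.
  exists (fun k => if k is j.+1 then u j else x).
  by move=> y [[k _ <-]|->]; [exists k.+1|exists 0%N].
have [t tP] := choice enumF.
exists (fun k => if unpickle k is Some (i, j) then t i j else x0).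
move=> y [i _ /tP [j _ <-]].
by exists (pickle (i, j)) => //=; rewrite pickleK.
Qed.

(** First countability at p of S, in a form that also controls sequences outside
    S that approach S.  Take disjoint neighbourhoods U_z of p and V_z of z
    for each z in S other than p, and let G_m be the intersection of the U_z
    for the first m + 1 points z of an enumeration of S.  Given an open
    neighbourhood W of p, finitely many V_z and W cover S, hence contain y_n
    for large n; since y_n is in G_n, it is in none of these V_z, so it is
    in W. *)
Lemma finite_sequence_union_nbhs_base (X : topologicalType) (S : set X) (p : X) :
  hausdorff_space X -> finite_sequence_unions S ->
  exists G : nat -> set X, (forall m, nbhs p (G m)) /\
    forall y : nat -> X, (forall m, G m (y m)) ->
      (forall O, open O -> S `<=` O -> \forall n \near \oo, O (y n)) ->
      y @ \oo --> p.
Proof.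
rewrite open_hausdorff => hX hS.
have [t St] := finite_sequence_union_enum hS.
have sep z : exists UV : set X * set X, [/\ nbhs p UV.1, open UV.2 &
    z <> p -> UV.2 z /\ UV.1 `&` UV.2 = set0].
  have [->|zp] := pselect (z = p).
    by exists (setT, setT); split=> //=; [exact: filterT|exact: openT].
  have [|[U V] /= [/set_mem Up /set_mem Vz] [oU oV /eqP UV0]] := hX p z.
    by apply/eqP => pz; apply: zp.
  by exists (U, V); split=> //=; exact: open_nbhs_nbhs.
have [UV UVP] := choice sep.
exists (fun m => [set y | forall k : 'I_m.+1, (UV (t k)).1 y]); split.
  by move=> m; apply: filter_forall => k; have [] := UVP (t k).
move=> y Gy Sy W; rewrite nbhsE => -[W' [oW' W'p] W'W].
pose c z := if pselect (z = p) is left _ then W' else (UV z).2.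
have oc z : open (c z) by rewrite /c; case: pselect => // _; have [] := UVP z.
have cz z : c z z.
  by rewrite /c; case: pselect => [->//|zp]; have [_ _ /(_ zp) []] := UVP z.
have [|s [sS Ss]] := finite_sequence_union_seq_compact (P := c) hS.
  move=> x _; split=> // u; apply; exact: open_nbhs_nbhs.
have [N sN] : exists N, forall z, z \in s -> exists2 k, (k <= N)%N & t k = z.
  elim: s sS {Ss} => [|z s IHs] sS; first by exists 0%N.
  have [|N sN] := IHs; first by move=> x xs; apply: sS; rewrite inE xs orbT.
  have [k _ tk] := St _ (sS z (mem_head _ _)).
  exists (maxn k N) => x; rewrite inE => /predU1P[->|/sN[j jN tj]].
    by exists k => //; exact: leq_maxl.
  by exists j => //; rewrite leq_max jN orbT.
have : \forall n \near \oo, (\bigcup_(z in [set` s]) c z) (y n).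
  apply: Sy; first by apply: bigcup_open => z _; exact: oc.
  by move=> x /Ss[z zs cx]; exists z.
apply: filterS2 (nbhs_infty_ge N) => n Nn [z /= zs].
rewrite /c; case: pselect => [_ /W'W//|zp Vy]; exfalso.
have [k kN tk] := sN z zs.
have kn : (k < n.+1)%N by rewrite ltnS (leq_trans kN).
have := Gy n (Ordinal kn); rewrite /= tk => Uy.
have [_ _ /(_ zp) [_ UV0]] := UVP z.
by have : ((UV z).1 `&` (UV z).2) (y n) by []; rewrite UV0.
Qed.

(** * The Vietoris topology *)

Lemma open_vietoris (X : topologicalType) r (U : 'I_r -> set X) :
  (forall i, open (U i)) -> open (vietoris U).
Proof.
move=> oU; exists [set vietoris U]; first by move=> _ ->; exists r, U.
by rewrite bigcup_set1.
Qed.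

Lemma nbhs_vietoris (X : topologicalType) (S : S_space X) (A : set (S_space X)) :
  nbhs S A -> exists (r : nat) (U : 'I_r -> set X),
    [/\ forall i, open (U i), vietoris U S & vietoris U `<=` A].
Proof.
rewrite nbhsE => -[B [[D DB <-] [C DC CS]] BA].
have [r [U [oU CE]]] := DB _ DC.
by exists r, U; rewrite -CE; split=> // T CT; apply: BA; exists C.
Qed.

Lemma near_vietoris_subset (X : topologicalType) (S : S_space X) (O : set X) :
  open O -> sval S `<=` O -> \forall T \near S, sval T `<=` O.
Proof.
move=> oO SO; have : open (vietoris (fun=> O : set X) : set (S_space X)).
  by move=> r; apply: open_vietoris.
move=> /(_ 1%N) oV; apply: filterS (open_nbhs_nbhs (conj oV _)).
  by move=> T [TO _] x /TO [].
split=> [x /SO Ox|_]; first by exists ord0.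
by have [x Sx] := S_space_neq0 S; exists x; split=> //; exact: SO.
Qed.

Lemma near_vietoris_meets (X : topologicalType) (S : S_space X) (O : set X) :
  open O -> sval S `&` O !=set0 -> \forall T \near S, sval T `&` O !=set0.
Proof.
move=> oO SO.
pose U (i : 'I_2) := if i == ord0 then O else setT.
have oU : open (vietoris U : set (S_space X)).
  by apply: open_vietoris => i; rewrite /U; case: ifP => _ //; exact: openT.
apply: filterS (open_nbhs_nbhs (conj oU _)); first by move=> T [_ /(_ ord0)].
split=> [x _|i]; first by exists ord_max.
rewrite /U; case: ifP => // _; rewrite setIT; exact: S_space_neq0.
Qed.

(** * Sequentially open sets of the hyperspace *)

(** Otherwise each G_m of the countable base at s would contain a point y_m,
    outside P, of some S_n with n >= m.  As S_n converges to S, the y_m lie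
    eventually in each open neighbourhood of S, so they converge to s, against
    the choice of P. *)
Lemma seq_nbhs_local_subset (X : topologicalType) (u : nat -> S_space X)
    (S : S_space X) (s : X) (P : set X) :
  hausdorff_space X -> u @ \oo --> S -> seq_nbhs s P ->
  exists2 O, nbhs s O & \forall n \near \oo, sval (u n) `&` O `<=` P.
Proof.
move=> hX uS [_ Ps]; apply: contrapT => noO.
have [G [nG cG]] := finite_sequence_union_nbhs_base s hX (set_valP S).
have bad m : exists ny : nat * X,
    [/\ (m <= ny.1)%N, sval (u ny.1) ny.2, G m ny.2 & ~ P ny.2].
  apply: contrapT => nbad; apply: noO; exists (G m) => //.
  exists m => // n /= mn x [ux Gx]; apply: contrapT => nPx.
  by apply: nbad; exists (n, x).
have [ny nyP] := choice bad.
have : (fun m => (ny m).2) @ \oo --> s.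
  apply: cG => [m|O oO SO]; first by have [] := nyP m.
  have [N _ uN] := uS _ (near_vietoris_subset oO SO).
  exists N => // m /= Nm; have [mn unm _ _] := nyP m.
  exact: (uN _ (leq_trans Nm mn)).
by move=> /Ps [N _ /(_ N (leqnn N))]; have [] := nyP N.
Qed.

(** The set <P_1, ..., P_r> for arbitrary sets, indexed by a sequence so that
    families of such sets can be counted. *)
Definition vietoris_seq (X : topologicalType) (l : seq (set X)) :
    set (S_space X) :=
  [set S | sval S `<=` [set x | exists2 P, P \in l & P x] /\
           forall P, P \in l -> sval S `&` P !=set0].

(** Around each point of S a neighbourhood O is found on which almost all S_n
    stay inside one of the P in l.  Finitely many such O cover S, hence S_n for
    almost all n, which gives the covering condition.  For the meeting
    condition, S_n eventually meets the interior of such an O, and does so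
    inside P. *)
Lemma seq_open_vietoris_seq (X : topologicalType) (l : seq (set X)) :
  hausdorff_space X -> (forall P, P \in l -> seq_open P) ->
  seq_open (vietoris_seq l).
Proof.
move=> hX ol S Sl; split=> // u uS.
have [Scov Smeet] := Sl.
have near_cov : \forall n \near \oo,
    sval (u n) `<=` [set x | exists2 P, P \in l & P x].
  have locO x : exists O, sval S x -> nbhs x O /\ \forall n \near \oo,
      sval (u n) `&` O `<=` [set x | exists2 P, P \in l & P x].
    have [Sx|] := pselect (sval S x); last by exists setT.
    have [P Pl Px] := Scov x Sx.
    have [O Ox uO] := seq_nbhs_local_subset hX uS (ol P Pl x Px).
    exists O => _; split=> //; apply: filterS uO => n uO y /uO Py.
    by exists P.
  have [O OP] := choice locO.
  have [|s [sS Ss]] :=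
      finite_sequence_union_seq_compact (P := fun x => (O x)°) (set_valP S).
    move=> x /OP [Ox _]; split; first exact: nbhs_singleton (nbhs_interior Ox).
    by move=> v; apply; exact: nbhs_interior.
  have : \forall n \near \oo, forall x, x \in s ->
      sval (u n) `&` O x `<=` [set x | exists2 P, P \in l & P x].
    elim: s sS {Ss} => [|x s IHs] sS; first exact: nearW.
    have xs := OP _ (sS x (mem_head _ _)).
    have {}IHs := IHs (fun y ys => sS y (@mem_behead _ (x :: s) _ ys)).
    apply: filterS2 xs.2 IHs => n ux us y.
    by rewrite inE => /predU1P[->//|]; exact: us.
  have : \forall n \near \oo, sval (u n) `<=` \bigcup_(x in [set` s]) (O x)°.
    apply: (uS _ (near_vietoris_subset _ _)) => [|y /Ss[x xs Oy]]; last by exists x.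
    by apply: bigcup_open => x _; exact: open_interior.
  apply: filterS2 => n un us y uy; have [x /= xs Oy] := un y uy.
  by apply: (us x xs); split=> //; apply: interior_subset; exact: Oy.
have near_meet : \forall n \near \oo, forall P, P \in l -> sval (u n) `&` P !=set0.
  elim: {near_cov Sl Scov} l ol Smeet => [|P l IHl] ol Smeet; first exact: nearW.
  have {}IHl := IHl (fun Q Ql => ol Q (@mem_behead _ (P :: l) _ Ql))
    (fun Q Ql => Smeet Q (@mem_behead _ (P :: l) _ Ql)).
  have [x [Sx Px]] := Smeet P (mem_head _ _).
  have [O Ox uO] := seq_nbhs_local_subset hX uS (ol P (mem_head _ _) x Px).
  have : \forall n \near \oo, sval (u n) `&` O° !=set0.
    apply: (uS _ (near_vietoris_meets _ _)); first exact: open_interior.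
    by exists x; split=> //; exact: nbhs_singleton (nbhs_interior Ox).
  apply: filterS3 IHl uO => n ul uO [y [uy Oy]] Q.
  rewrite inE => /predU1P[->|]; last exact: ul.
  by exists y; split=> //; apply: uO; split=> //; apply: interior_subset; exact: Oy.
by apply: filterS2 near_cov near_meet.
Qed.
(** * From so-networks of the hyperspace to so-networks of the space *)

Lemma seq_open_preimage (X Y : topologicalType) (f : X -> Y) (A : set Y) :
  continuous f -> seq_open A -> seq_open (f @^-1` A).
Proof.
move=> cf oA x Afx; split=> // u ux; have [_ ofx] := oA _ Afx.
apply: (ofx (f \o u)); exact: cvg_comp ux (cf x).
Qed.

Lemma finite_sequence_unions_set1 (X : topologicalType) (x : X) :
  finite_sequence_unions [set x].
Proof.
split; first by exists x.
exists 1%N, (fun=> [set x]); split=> [_|]; last first.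
  by apply/seteqP; split=> [y ->|y [_ _ ->]] //; exists ord0.
exists (fun=> x), x; split; first exact: cvg_cst.
by apply/seteqP; split=> [y ->|y [[_ _ <-]|->]] //; right.
Qed.

Definition S_singleton (X : topologicalType) (x : X) : S_space X :=
  SigSub (mem_set (finite_sequence_unions_set1 x)).

Lemma S_singleton_continuous (X : topologicalType) :
  continuous (@S_singleton X).
Proof.
move=> x A /nbhs_vietoris[r [U [oU [xU Ux] UA]]].
have [i0 _ Ui0] := xU x erefl.
have : \forall y \near x, forall j, U j y.
  apply: filter_forall => j; have [y [-> Uy]] := Ux j.
  exact: open_nbhs_nbhs.
have : nbhs x (U i0) by exact: open_nbhs_nbhs.
apply: filterS2 => y Uy0 Uy; apply: UA; split=> [z ->|j]; first by exists i0.
by exists y.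
Qed.

Lemma so_network_at_nbhs (Y : topologicalType) (y : Y) (P : set (set Y)) U :
  so_network_at y P -> nbhs y U -> exists2 A, P A & A y /\ A `<=` U.
Proof.
move=> [_ _ Pref]; rewrite nbhsE => -[V [oV Vy] VU].
by have [A PA [Ay AV]] := Pref V oV Vy; exists A => //; split=> // z /AV /VU.
Qed.

Lemma so_network_pullback (X : topologicalType) (N : set (set (S_space X))) :
  @so_network (S_space X) N -> exists2 M, @so_network X M & M #<= N.
Proof.
move=> [_ [Ny [NyP ->]]].
pose Mx (x : X) := preimage (@S_singleton X) @` Ny (S_singleton x).
have MxP x : so_network_at x (Mx x).
  have [Nopen Nfilt _] := NyP (S_singleton x); split.
  - move=> _ [A NA <-]; have [oA Ax] := Nopen A NA; split=> //.
    exact: seq_open_preimage (@S_singleton_continuous X) oA.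
  - move=> _ _ [A NA <-] [B NB <-]; have [C NC CAB] := Nfilt A B NA NB.
    by exists (@S_singleton X @^-1` C); [exists C|move=> y /CAB].
  - move=> U oU Ux.
    have SU : \forall T \near S_singleton x, sval T `<=` U.
      by apply: near_vietoris_subset => // _ ->.
    have [A NA [Ax AU]] := so_network_at_nbhs (NyP _) SU.
    exists (@S_singleton X @^-1` A); first by exists A.
    by split=> // y /AU; apply.
exists (\bigcup_x Mx x).
  split; last by exists Mx.
  apply/seteqP; split=> // x _.
  have [A MA [Ax _]] := so_network_at_nbhs (MxP x) filterT.
  by exists A => //; exists x.
apply: card_le_trans _ (card_image_le (preimage (@S_singleton X)) _).
apply: subset_card_le => _ [x _ [A NA <-]]; exists A => //.
by exists (S_singleton x).
Qed.

(** * From so-networks of the space to so-networks of the hyperspace *)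

(** Sequentially open sets are closed under finite intersections, so a family of
    them that refines open neighbourhoods generates an so-network: the local
    network at y consists of all the finite intersections that contain y.
    Intersections equal to the empty set are left out because they belong to no
    local network. *)
Lemma so_network_finI (Y : topologicalType) (B : set (set Y)) :
  (forall A, B A -> seq_open A) ->
  (forall y U, open U -> U y -> exists2 A, B A & A y /\ A `<=` U) ->
  so_network [set A | A !=set0 /\
    exists l : seq (set Y), (forall b, b \in l -> B b) /\
      A = \bigcap_(b in [set` l]) b].
Proof.
move=> Bo Bref; set M := (X in so_network X).
have MB A y : B A -> A y -> M A.
  move=> BA Ay; split; first by exists y.
  exists [:: A]; split=> [b|]; first by rewrite inE => /eqP ->.
  apply/seteqP; split=> [z Az b /=|z]; first by rewrite inE => /eqP ->.
  by apply; rewrite /= mem_head.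
split.
  apply/seteqP; split=> // y _; have [A BA [Ay _]] := Bref y setT openT I.
  by exists A => //; exact: MB Ay.
exists (fun y => [set A | M A /\ A y]); split; last first.
  apply/seteqP; split=> [A MA|A [y _ []]//].
  by have [[y Ay] _] := MA; exists y.
move=> y; split.
- move=> _ [[_ [l [lB ->]]] ly]; split=> // z lz; split=> // u uz.
  have : \forall n \near \oo, forall b, b \in l -> b (u n).
    elim: l lB {ly} lz => [|b l IHl] lB lz; first exact: nearW.
    have bz : b z by apply: lz; rewrite /= mem_head.
    have [_ /(_ u uz)] := Bo b (lB b (mem_head _ _)) z bz.
    have lB' c : c \in l -> B c by move=> cl; apply: lB; rewrite inE cl orbT.
    have lz' : (\bigcap_(c in [set` l]) c) z.
      by move=> c /= cl; apply: lz; rewrite /= inE cl orbT.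
    apply: filterS2 (IHl lB' lz') => n un bn c.
    by rewrite inE => /predU1P[->//|/un].
  by apply: filterS => n un b; exact: un.
- move=> _ _ [[_ [l [lB ->]]] ly] [[_ [k [kB ->]]] ky].
  exists (\bigcap_(b in [set` l ++ k]) b); last first.
    by move=> z lkz; split=> b bl; apply: lkz; rewrite /= mem_cat bl ?orbT.
  have lky : (\bigcap_(b in [set` l ++ k]) b) y.
    by move=> b /=; rewrite mem_cat => /orP[/ly|/ky].
  split=> //; split; first by exists y.
  by exists (l ++ k); split=> // b; rewrite mem_cat => /orP[/lB|/kB].
- move=> U oU Uy; have [A BA [Ay AU]] := Bref y U oU Uy.
  by exists A => //; split=> //; exact: MB Ay.
Qed.

(** Given a basic neighbourhood <U_1, ..., U_r> of S, choose for each x in S a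
    member P_x of its local network inside all the U_i that contain x.  Finitely
    many P_x cover S; those of a point of each S `&` U_i are added, so that
    a set meeting all of them meets each U_i. *)
Lemma vietoris_seq_refines (X : topologicalType) (Nx : X -> set (set X))
    (S : S_space X) (W : set (S_space X)) :
  (forall x, so_network_at x (Nx x)) -> nbhs S W ->
  exists l : seq (set X), [/\ forall P, P \in l -> exists x, Nx x P,
    vietoris_seq l S & vietoris_seq l `<=` W].
Proof.
move=> NxP /nbhs_vietoris[r [U [oU [SU SmU] UW]]].
have locP x : exists P, Nx x P /\ P x /\ P `<=` [set y | forall i, U i x -> U i y].
  have nU : \forall y \near x, forall i, U i x -> U i y.
    apply: filter_forall => i; have [Uix|nUix] := pselect (U i x).
      by apply: filterS (open_nbhs_nbhs (conj (oU i) Uix)) => y.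
    by apply: nearW => y /nUix.
  by have [P NP PU] := so_network_at_nbhs (NxP x) nU; exists P.
have [P PP] := choice locP.
have Px x : P x x by have [_ []] := PP x.
have PU x i : U i x -> P x `<=` U i.
  by move=> Ux y /(PP x).2.2; apply.
have [|s [sS Ss]] := finite_sequence_union_seq_compact (P := P) (set_valP S).
  by move=> x Sx; have [No _ _] := NxP x; have [/No [/(_ _ (Px x))]] := PP x.
have [a aP] := choice SmU.
have lS x : x \in s ++ [seq a j | j <- enum 'I_r] -> sval S x.
  by rewrite mem_cat => /orP[/sS//|/mapP[j _ ->]]; have [] := aP j.
exists [seq P x | x <- s ++ [seq a j | j <- enum 'I_r]]; split.
- by move=> _ /mapP[x _ ->]; exists x; have [] := PP x.
- split=> [y /Ss[x xs Pxy]|_ /mapP[x /lS Sx ->]]; last by exists x.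
  by exists (P x) => //; apply/mapP; exists x; rewrite // mem_cat xs.
- move=> T [Tcov Tmeet]; apply: UW; split=> [y /Tcov[_ /mapP[x /lS Sx ->] Pxy]|j].
    by have [i _ Ui] := SU x Sx; exists i => //; exact: PU Pxy.
  have [|y [Ty Py]] := Tmeet (P (a j)).
    by apply/mapP; exists (a j) => //; rewrite mem_cat map_f ?orbT ?mem_enum.
  by exists y; split=> //; have [_ Ua] := aP j; exact: PU Ua _ Py.
Qed.

Lemma seq_in_range (T : Type) (U : eqType) (f : T -> U) (s : seq U) :
  (forall x, x \in s -> range f x) -> exists t, s = map f t.
Proof.
elim: s => [|x s IHs] sf; first by exists [::].
have [a _ fa] := sf x (mem_head _ _).
have [|t ->] := IHs; first by move=> y ys; apply: sf; rewrite inE ys orbT.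
by exists (a :: t); rewrite /= fa.
Qed.

(** * Comparison of the weights *)

Lemma so_weight_infinite (Y : topologicalType) :
  [set: nat] #<= [set: so_weight Y].
Proof.
rewrite (card_le_eqr (card_setT _)).
apply: (@injection_card_le _ _ _ _ inl) => [n _|m n _ _ [] //].
by left; exists n.
Qed.

(** Aleph_0 is absorbed: a disjoint union of two sets that embed in an infinite
    set T embeds in the sequences over T, by sequences of lengths 1 and 2. *)
Lemma so_weight_le (Y Z : topologicalType) :
  min_so_network Y #<= so_weight Z -> so_weight Y #<= so_weight Z.
Proof.
move=> YZ; have natZ := so_weight_infinite Z.
have z0 : so_weight Z.
  exact: SigSub (mem_set (or_introl (ex_intro2 _ _ 0%N I erefl))).
have {YZ} : min_so_network Y #<= [set: so_weight Z].
  by rewrite (card_le_eqr (card_setT _)).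
move=> /(card_le_injection z0)[h [_ hI]].
have [g [_ gI]] := card_le_injection z0 natZ.
rewrite -(card_le_eqr (card_setT (so_weight Z))).
apply: card_le_trans _ (infinite_card_seq natZ).
pose c (v : nat + set Y) := match v with
  inl n => [:: g n] | inr A => [:: h A; h A] end.
apply: (@injection_card_le _ _ _ _ c) => // v v'.
move=> [[m _ <-]|[A MA <-]] [[n _ <-]|[B MB <-]] //= [].
  by move=> /(gI _ _ I I) ->.
by move=> /(hI _ _ MA MB) ->.
Qed.

Lemma min_so_network_S_space_le (X : topologicalType) :
  hausdorff_space X -> min_so_network (S_space X) #<= so_weight X.
Proof.
move=> hX; have [[_ [Nx [NxP NE]]] _] := min_so_networkP X.
pose B := [set vietoris_seq l | l in
  [set l : seq (set X) | forall P, P \in l -> min_so_network X P]].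
have Bo A : B A -> seq_open A.
  move=> [l lN <-]; apply: seq_open_vietoris_seq => // P /lN.
  by rewrite NE => -[x _ NxP']; have [/(_ P NxP') []] := NxP x.
have Bref S W : open W -> W S -> exists2 A, B A & A S /\ A `<=` W.
  move=> oW WS; have nW : nbhs S W by exact: open_nbhs_nbhs.
  have [l [lN lS lW]] := vietoris_seq_refines NxP nW.
  exists (vietoris_seq l) => //; exists l => // P /lN [x Px].
  by rewrite NE; exists x.
apply: card_le_trans ((min_so_networkP _).2 _ (so_network_finI Bo Bref)) _.
rewrite -(card_le_eqr (card_setT (so_weight X))).
have natX := so_weight_infinite X.
have natsX : [set: nat] #<= [set: seq (so_weight X)].
  apply: card_le_trans natX _.
  by apply: (@injection_card_le _ _ _ _ (cons^~ [::])) => // v w _ _ [].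
apply: card_le_trans _ (infinite_card_seq natX).
apply: card_le_trans _ (infinite_card_seq natsX).
(* Decoding of the elements of the weight as members of the network; the
   elements coming from nat get an arbitrary value. *)
pose dec (w : so_weight X) : set X := if val w is inr A then A else setT.
pose f L := \bigcap_(b in [set` [seq vietoris_seq (map dec l) | l <- L]]) b.
apply: card_le_trans _ (card_image_le f _).
apply: subset_card_le => _ [_ [lb [lbB ->]]].
have [|L LE] := @seq_in_range _ _ (fun l => vietoris_seq (map dec l)) lb.
  move=> _ /lbB[l lN <-].
  have [|k ->] := @seq_in_range _ _ dec l; last by exists k.
  move=> P /lN NP.
  have w : so_weight X (inr P) by right; exists P.
  by exists (SigSub (mem_set w)).
by exists L => //; rewrite /f -LE.
Qed.

Theorem theorem4p17 (X : topologicalType) (hX : hausdorff_space X) :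
  (so_weight X #= so_weight (S_space X))%card.
Proof.
rewrite card_eq_le; apply/andP; split; apply: so_weight_le; last first.
  exact: min_so_network_S_space_le.
have [M MX MS] := so_network_pullback (min_so_networkP (S_space X)).1.
apply: card_le_trans ((min_so_networkP X).2 M MX) (card_le_trans MS _).
by apply: (@injection_card_le _ _ _ _ inr) => [A NA|A A' _ _ [] //]; right; exists A.
Qed.
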